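(* Let $n\ge 2$, let $W=[w_{ij}]\in\mathbb R^{n\times n}$ be the weight matrix of a directed graph with no isolated point, let $T(x)=\sum_{i,j=1}^n w_{ij}[x_i-x_j]_+$ for $x\in\mathbb R^n$, and let $Q$ be an $n\times n$ diagonal matrix with positive diagonal entries. Let $u_1,u_2,\dots,u_n$ be the constant vector $u_1$ together with a set of $(T,Q)$-graph Fourier modes $u_2,\dots,u_n$. Given $1\le k\le n-1$, let $X=\{x\in\mathbb R^n: U_k^\top Qx=0\}$ with $U_k=(u_1,\dots,u_k)$, let $m=n-k$, and let $V=(v_1,\dots,v_m)\in\mathbb R^{n\times m}$ have as columns an orthonormal basis of $X$. If the set $$\mathcal N:=\{x\in\mathbb R^m: \|x\|=1,\ T(Vx)=0\}$$ is finite, then the problem $$\min_{x\in\mathbb R^m\setminus\{0\}}\frac{T(Vx)}{\|Q^{1/2}Vx\|}$$ has only a finite number of critical points.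
   Context: Here $[t]_+=\max(0,t)$, $\|\cdot\|$ is the Euclidean norm, and the weights satisfy $w_{ij}\ge 0$, with $w_{ij}>0$ exactly when there is an edge from $i$ to $j$. The $(T,Q)$-graph Fourier modes are defined recursively: with $\mathbf 1=(1,\dots,1)^\top\in\mathbb R^n$, $u_1=\mathbf 1/\|Q^{1/2}\mathbf 1\|$, and for $j=2,\dots,n$, $u_j$ is a solution of $\min T(x)$ subject to $U_{j-1}^\top Qx=0$ and $\|Q^{1/2}x\|=1$, where $U_{j-1}=(u_1,\dots,u_{j-1})$. Critical points: let $\tilde T(x)=T(Vx)$, $\tilde B(x)=\|Q^{1/2}Vx\|$ and $E(x)=\tilde T(x)/\tilde B(x)$ for $x\in\mathbb R^m\setminus\{0\}$. A critical point of the problem $\min_{x\in\mathbb R^m\setminus\{0\}}E(x)$ is a point $x^*\in\mathbb R^m$ with $\|x^*\|=1$ such that $E(x^* )\,\partial\tilde B(x^* )\cap\partial\tilde T(x^* )\ne\emptyset$, where $\partial$ is the convex subdifferential. (Thus critical points are by definition taken on the unit sphere.) *)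

(* Defs.v *)
From HB Require Import structures.
From mathcomp Require Import all_boot all_order all_algebra.
From mathcomp Require Import boolp classical_sets functions cardinality reals.

Set Implicit Arguments.
Unset Strict Implicit.
Unset Printing Implicit Defensive.
Import Order.TTheory GRing.Theory Num.Theory.
Local Open Scope classical_set_scope.
Local Open Scope ring_scope.

Section EuclideanSpace.
Context {R : realType} {n : nat}.
Implicit Types (x y p : 'cV[R]_n) (f : 'cV[R]_n -> R).

Definition edot x y : R := \sum_i x i 0 * y i 0.

(* MathComp-Analysis norms matrices by the sup norm, hence this definition. *)
Definition enorm x : R := Num.sqrt (edot x x).

Definition subdifferential f x : set 'cV[R]_n :=
  [set p | forall y, f x + edot p (y - x) <= f y].

Definition is_minimizer f (D : set 'cV[R]_n) x : Prop :=
  D x /\ forall y, D y -> f x <= f y.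

(* Critical points of the problem of minimizing T x / B x over x != 0. *)
Definition critical_points (T B : 'cV[R]_n -> R) : set 'cV[R]_n :=
  [set x | enorm x = 1 /\
    ([set (T x / B x) *: p | p in subdifferential B x]
       `&` subdifferential T x) !=set0].

Definition orthonormal_basis m (V : 'M[R]_(n, m)) (X : set 'cV[R]_n) : Prop :=
  (forall i j, edot (col i V) (col j V) = (i == j)%:R) /\
  X = [set V *m y | y in [set: 'cV[R]_m]].

End EuclideanSpace.

Section GraphFourierModes.
Context {R : realType} {n : nat}.
Implicit Types (W Q : 'M[R]_n) (x : 'cV[R]_n) (u : nat -> 'cV[R]_n).

(* There is an edge from i to j exactly when 0 < W i j. A vertex whose only
   edge is a loop counts as isolated; loops do not contribute to dvar. *)
Definition no_isolated_point W : Prop :=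
  forall i, exists j, j != i /\ (0 < W i j \/ 0 < W j i).

Definition dvar W x : R :=
  \sum_i \sum_j W i j * Num.max 0 (x i 0 - x j 0).

(* Q^(1/2), for Q diagonal with nonnegative diagonal entries. *)
Definition diag_sqrt Q : 'M[R]_n := diag_mx (\row_i Num.sqrt (Q i i)).

(* The matrix (u_1, ..., u_k); families of vectors are indexed from 1. *)
Definition colsmx u (k : nat) : 'M[R]_(n, k) := \matrix_(i < n, j < k) u j.+1 i 0.

Definition orthoQ Q u (k : nat) : set 'cV[R]_n :=
  [set x | (colsmx u k)^T *m Q *m x = 0].

(* Only the values u 1, ..., u n are constrained. *)
Definition fourier_modes (T : 'cV[R]_n -> R) Q u : Prop :=
  u 1%N = (enorm (diag_sqrt Q *m const_mx 1))^-1 *: const_mx 1 /\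
  forall j, (2 <= j <= n)%N ->
    is_minimizer T
      (orthoQ Q u j.-1 `&` [set x | enorm (diag_sqrt Q *m x) = 1]) (u j).

End GraphFourierModes.

(* Main.v *)
Require Import Defs.
From mathcomp Require Import all_boot all_order all_algebra.
From mathcomp Require Import boolp classical_sets functions cardinality reals.
From mathcomp Require Import ring lra.

Set Implicit Arguments.
Unset Strict Implicit.
Unset Printing Implicit Defensive.
Import Order.TTheory GRing.Theory Num.Theory.
Local Open Scope classical_set_scope.
Local Open Scope ring_scope.

(* Write T for x |-> dvar W (V *m x) and B x = sqrt (x^T A x) with A positive
   definite.  At a critical point x the only subgradient of B is A x / B x, so
   mu A x is a subgradient of T at x, where mu = T x / B x ^ 2.  T is linear on
   each cone of points V *m x whose coordinates are ordered in a given way, so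
   if y is another critical point in the same cone, with multiplier nu, then
   mu x^T A y = T y and nu x^T A y = T x.  Hence mu x - nu y has zero A-norm, and
   x = y as soon as T x and T y are nonzero.  There are finitely many orderings
   of the coordinates, and the critical points with T x = 0 lie in the finite
   set of the hypothesis. *)

Section Edot.
Context {R : realType} {n : nat}.
Implicit Types x y z : 'cV[R]_n.

Lemma edotC x y : edot x y = edot y x.
Proof. by apply: eq_bigr => i _; rewrite mulrC. Qed.

Lemma edotDr x y z : edot x (y + z) = edot x y + edot x z.
Proof. by rewrite -big_split; apply: eq_bigr => i _; rewrite mxE mulrDr. Qed.

Lemma edotZr c x y : edot x (c *: y) = c * edot x y.
Proof. by rewrite mulr_sumr; apply: eq_bigr => i _; rewrite mxE mulrCA. Qed.

Lemma edotBr x y z : edot x (y - z) = edot x y - edot x z.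
Proof. by rewrite -scaleN1r edotDr edotZr mulN1r. Qed.

Lemma edotDl x y z : edot (x + y) z = edot x z + edot y z.
Proof. by rewrite edotC edotDr !(edotC z). Qed.

Lemma edotZl c x y : edot (c *: x) y = c * edot x y.
Proof. by rewrite edotC edotZr edotC. Qed.

Lemma edotBl x y z : edot (x - y) z = edot x z - edot y z.
Proof. by rewrite edotC edotBr !(edotC z). Qed.

Lemma edotxx_ge0 x : 0 <= edot x x.
Proof. by apply: sumr_ge0 => i _; rewrite -expr2 sqr_ge0. Qed.

Lemma edotxx_eq0 x : edot x x = 0 -> x = 0.
Proof.
move=> /eqP; rewrite psumr_eq0 => [/allP x0|i _]; last by rewrite -expr2 sqr_ge0.
apply/colP => i; rewrite mxE; apply/eqP.
by have := x0 i (mem_index_enum _); rewrite mulf_eq0 orbb.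
Qed.

Lemma enorm_sqr x : enorm x ^+ 2 = edot x x.
Proof. by rewrite sqr_sqrtr ?edotxx_ge0. Qed.

Lemma enorm_ge0 x : 0 <= enorm x.
Proof. exact: sqrtr_ge0. Qed.

Lemma enormZ c x : 0 <= c -> enorm (c *: x) = c * enorm x.
Proof.
move=> c0; rewrite /enorm edotZl edotZr mulrA -expr2 sqrtrM ?sqr_ge0 //.
by rewrite sqrtr_sqr ger0_norm.
Qed.

End Edot.

(** * Subgradients of positively homogeneous functions and of Euclidean seminorms *)

Section Subgradients.
Context {R : realType} {m : nat}.
Implicit Types (x y p : 'cV[R]_m) (f : 'cV[R]_m -> R).

(** Testing the subgradient inequality at [2 *: x] and at [0] gives the two halves of Euler's
    identity, which then cancels the base point. *)
Lemma subdifferential_homogeneous f x p :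
  (forall c y, 0 <= c -> f (c *: y) = c * f y) -> subdifferential f x p ->
  edot p x = f x /\ forall y, edot p y <= f y.
Proof.
move=> fZ px.
have f0 : f 0 = 0 by rewrite -(scale0r 0) fZ // mul0r.
have pxE : edot p x = f x.
  apply/eqP; rewrite eq_le; apply/andP; split.
    have := px (2 *: x); rewrite fZ // edotBr edotZr; lra.
  have := px 0; rewrite edotBr f0 -(scale0r 0) edotZr; lra.
split=> // y; have := px y; rewrite edotBr; lra.
Qed.

(** This is the gradient formula for the norm with its denominator cleared, so it also covers
    [L *m x = 0]. *)
Lemma subdifferential_enorm n (L : 'M[R]_(n, m)) x p :
  subdifferential (fun y => enorm (L *m y)) x p ->
  forall y, enorm (L *m x) * edot p y = edot (L *m x) (L *m y).
Proof.
move=> /subdifferential_homogeneous[c y c0|px ple y].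
  by rewrite -scalemxAr enormZ.
have psqr z : edot p z ^+ 2 <= edot (L *m z) (L *m z).
  rewrite -enorm_sqr -real_normK ?num_real // ler_sqr ?nnegrE ?enorm_ge0 //.
  rewrite ler_norml ple andbT lerNl -mulN1r -edotZr.
  apply: le_trans (ple _) _.
  by rewrite -scalemxAr scaleN1r /enorm -scaleN1r edotZl edotZr !mulN1r opprK.
(* The form <Lz, Lz> - <p, z>^2 is positive semidefinite and vanishes at x. *)
set c := edot (L *m x) (L *m y) - edot p x * edot p y.
set d := edot (L *m y) (L *m y) - edot p y ^+ 2.
have d_ge0 : 0 <= d by rewrite subr_ge0.
have quad t : 0 <= 2 * t * c + t ^+ 2 * d.
  have := psqr (x + t *: y).
  rewrite mulmxDr -scalemxAr !(edotDl, edotDr, edotZl, edotZr).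
  rewrite (edotC (L *m y)) px -(enorm_sqr (L *m x)) /c /d px; lra.
(* The minimiser [- c / d] of the quadratic is undefined when [d = 0]; [t = - c / (d + 1)] always
   exists and still makes it negative unless [c = 0]. *)
have d1 : d + 1 != 0 by rewrite gt_eqF // ltr_wpDl.
have : 0 <= - (c / (d + 1)) ^+ 2 * (d + 2).
  have := quad (- (c / (d + 1))).
  suff -> : 2 * - (c / (d + 1)) * c + (- (c / (d + 1))) ^+ 2 * d
          = - (c / (d + 1)) ^+ 2 * (d + 2) by [].
  by field.
rewrite mulNr oppr_ge0 pmulr_lle0; last by rewrite ltr_wpDl.
rewrite le_eqVlt ltNge sqr_ge0 orbF sqrf_eq0 mulf_eq0 invr_eq0 (negPf d1) orbF.
by rewrite subr_eq0 px => /eqP.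
Qed.

End Subgradients.

(** * Piecewise linearity of the directed variation *)

Section DirectedVariation.
Context {R : realType} {n : nat}.
Variable W : 'M[R]_n.
Implicit Types x y z : 'cV[R]_n.

Lemma dvarZ c x : 0 <= c -> dvar W (c *: x) = c * dvar W x.
Proof.
move=> c0; rewrite /dvar mulr_sumr; apply: eq_bigr => i _.
rewrite mulr_sumr; apply: eq_bigr => j _.
by rewrite !mxE -mulrBr mulrCA (maxr_pMr _ _ c0) mulr0.
Qed.

Lemma dvar_ge0 x : (forall i j, 0 <= W i j) -> 0 <= dvar W x.
Proof.
move=> W_ge0; apply: sumr_ge0 => i _; apply: sumr_ge0 => j _.
by rewrite mulr_ge0 // le_max lexx.
Qed.

(** Encodes the weak order of the coordinates, a tie being a pair absent in both orientations. The
    finite codomain is what bounds the number of cells. *)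
Definition strict_pairs x : {set 'I_n * 'I_n} := [set ij | x ij.2 0 < x ij.1 0]%SET.

(** For [M] large, [M *: x - y] reverses no strict inequality between coordinates of [x], so every
    summand stays on the same linear piece. *)
Lemma dvar_subtract x y : strict_pairs x = strict_pairs y ->
  exists2 M, 0 <= M & dvar W (M *: x - y) = M * dvar W x - dvar W y.
Proof.
move=> /setP xy.
have {}xy i j : (x j 0 < x i 0) = (y j 0 < y i 0).
  by have := xy (i, j); rewrite !inE.
(* [r ij] is the least multiple of [x] that keeps the pair [ij] in order after subtracting [y].
   These ratios are nonnegative, so their sum dominates each of them. *)
pose r (ij : 'I_n * 'I_n) := (y ij.1 0 - y ij.2 0) / (x ij.1 0 - x ij.2 0).
have r_ge0 ij : x ij.2 0 < x ij.1 0 -> 0 <= r ij.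
  by move=> lx; rewrite divr_ge0 // subr_ge0 ltW // -xy.
exists (\sum_(ij | x ij.2 0 < x ij.1 0) r ij); first exact: sumr_ge0.
set M := \sum_(_ | _) _.
have Mge i j : x j 0 < x i 0 -> y i 0 - y j 0 <= M * (x i 0 - x j 0).
  move=> lx; rewrite -ler_pdivrMr ?subr_gt0 //.
  by rewrite /M (bigD1 (i, j)) //= lerDl sumr_ge0 // => ij /andP[/r_ge0].
rewrite /dvar mulr_sumr -sumrB; apply: eq_bigr => i _.
rewrite mulr_sumr -sumrB; apply: eq_bigr => j _.
rewrite !mxE mulrCA -mulrBr; congr (_ * _).
case: (ltgtP (x j 0) (x i 0)) => [lx|lx|ex].
- have ly := lx; rewrite xy in ly; have := Mge _ _ lx => ?.
  by rewrite !max_r; lra.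
- have ly := lx; rewrite xy in ly; have := Mge _ _ lx => ?.
  by rewrite !max_l; lra.
- have ey : y j 0 = y i 0.
    by apply/eqP; rewrite eq_le !leNgt -!xy ex ltxx.
  by rewrite ex ey !subrr maxxx mulr0 subrr.
Qed.

End DirectedVariation.

(** * At most one critical point with nonzero variation in each cell *)

Section CriticalPoints.
Context {R : realType} {n m : nat}.
Variables (W : 'M[R]_n) (V L : 'M[R]_(n, m)).
Hypothesis W_ge0 : forall i j, 0 <= W i j.
Hypothesis L_inj : forall x : 'cV[R]_m, L *m x = 0 -> x = 0.
Local Notation T := (fun x : 'cV[R]_m => dvar W (V *m x)).
Local Notation B := (fun x : 'cV[R]_m => enorm (L *m x)).
Local Notation A x y := (edot (L *m x) (L *m y)).
Implicit Types x y : 'cV[R]_m.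

Lemma enorm1_neq0 x : enorm x = 1 -> x <> 0.
Proof.
move=> x1 x0; have := x1.
by rewrite x0 -(scale0r x) enormZ // mul0r => /esym/eqP; rewrite oner_eq0.
Qed.

(** One factor [B x] of the denominator [A x x] comes from the quotient [T x / B x], the other from
    the gradient of [B]. *)
Lemma critical_subgradient x : critical_points T B x ->
  exists2 q, subdifferential T x q &
    forall y, edot q y = T x / A x x * A x y.
Proof.
move=> [x1 [_ [[p px <-] qx]]]; exists (T x / B x *: p) => // y.
have Lx0 : enorm (L *m x) != 0.
  apply/eqP => Lx0; apply: (enorm1_neq0 x1); apply: L_inj.
  by apply: edotxx_eq0; rewrite -enorm_sqr Lx0 expr0n.
by rewrite edotZl -(subdifferential_enorm px y) -enorm_sqr /=; field.
Qed.

(** Homogeneity gives [edot q y <= T y]; the same bound at [M *: x - y], where [T] is additive,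
    gives the converse. *)
Lemma subgradient_same_cell x y q : strict_pairs (V *m x) = strict_pairs (V *m y) ->
  subdifferential T x q -> edot q y = T y.
Proof.
move=> /(dvar_subtract W)[M M0 TM] /subdifferential_homogeneous[c z c0|qx qle].
  by rewrite -scalemxAr dvarZ.
apply/eqP; rewrite eq_le qle /=; have := qle (M *: x - y).
by rewrite edotBr edotZr qx mulmxBr -scalemxAr TM; lra.
Qed.

Lemma critical_same_cell x y : T x != 0 -> T y != 0 ->
  critical_points T B x -> critical_points T B y ->
  strict_pairs (V *m x) = strict_pairs (V *m y) -> x = y.
Proof.
move=> Tx0 Ty0 cx cy xy.
have multiplier z : T z != 0 -> critical_points T B z ->
    0 < T z / A z z /\ T z / A z z * A z z = T z.
  move=> Tz0 [z1 _].
  have Az : A z z != 0.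
    by apply/eqP => /edotxx_eq0/L_inj/(enorm1_neq0 z1).
  split; last by field.
  by rewrite divr_gt0 // lt_def ?Tz0 ?Az //= ?edotxx_ge0 ?dvar_ge0.
have [mu_gt0 muE] := multiplier x Tx0 cx.
have [nu_gt0 nuE] := multiplier y Ty0 cy.
have [p px pE] := critical_subgradient cx.
have [q qy qE] := critical_subgradient cy.
have := subgradient_same_cell xy px; rewrite pE => muy.
have := subgradient_same_cell (esym xy) qy; rewrite qE edotC => nux.
set mu := T x / _ in mu_gt0 muE muy; set nu := T y / _ in nu_gt0 nuE nux.
have /eqP : mu *: x - nu *: y = 0.
  apply/L_inj/edotxx_eq0; rewrite mulmxBr -!scalemxAr.
  rewrite !(edotBl, edotBr, edotZl, edotZr) (edotC (L *m y) (L *m x)).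
  (* The two cross terms are bracketed differently, so that [muy] rewrites one and [nux] the other;
     the four terms then cancel in pairs. *)
  transitivity (mu * (mu * A x x) - nu * (mu * A x y) - mu * (nu * A x y)
    + nu * (nu * A y y)); first by ring.
  by rewrite muE nuE muy nux; ring.
rewrite subr_eq0 => /eqP munu.
(* Both points lie on the unit sphere, so taking norms equates the multipliers. *)
have mn : mu = nu.
  have [[x1 _] [y1 _]] := (cx, cy).
  by move/(congr1 enorm): munu; rewrite !enormZ ?ltW // x1 y1 !mulr1.
by move: munu; rewrite mn => /(scalerI (lt0r_neq0 nu_gt0)).
Qed.

Lemma finite_critical_points :
  finite_set [set x : 'cV[R]_m | enorm x = 1 /\ T x = 0] ->
  finite_set (critical_points T B).
Proof.
move=> finN; set C := critical_points T B.
apply: (@sub_finite_set _ _ ([set x : 'cV[R]_m | enorm x = 1 /\ T x = 0]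
    `|` [set x | C x /\ T x != 0])).
  move=> x Cx; have [Tx0|Tx0] := eqVneq (T x) 0; [left|by right].
  by split=> //; case: Cx.
rewrite finite_setU; split=> //.
have inj : {in [set x | C x /\ T x != 0] &,
    injective (fun x => strict_pairs (V *m x))}.
  move=> x y; rewrite !inE => -[Cx Tx0] [Cy Ty0].
  exact: critical_same_cell.
by rewrite -(eq_finite_set (inj_card_eq inj)); exact: finite_finset.
Qed.

End CriticalPoints.

Lemma diag_sqrt_mul_eq0 (R : realType) n (Q : 'M[R]_n) (x : 'cV[R]_n) :
  (forall i, 0 < Q i i) -> diag_sqrt Q *m x = 0 -> x = 0.
Proof.
move=> Q_gt0 /colP Qx; apply/colP => i; rewrite mxE; apply/eqP.
have /eqP := Qx i; rewrite mul_diag_mx !mxE mulf_eq0 sqrtr_eq0.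
by rewrite leNgt Q_gt0.
Qed.

Lemma orthonormal_basis_mul_eq0 (R : realType) n m (V : 'M[R]_(n, m)) X (x : 'cV[R]_m) :
  orthonormal_basis V X -> V *m x = 0 -> x = 0.
Proof.
move=> [V_on _] Vx; rewrite -(mul1mx x).
suff <- : V^T *m V = 1%:M by rewrite -mulmxA Vx mulmx0.
apply/matrixP => i j; rewrite !mxE -V_on.
by apply: eq_bigr => l _; rewrite !mxE.
Qed.

Theorem theorem6p1 (R : realType) (n : nat) (n_ge2 : (2 <= n)%N)
  (W : 'M[R]_n) (W_ge0 : forall i j, 0 <= W i j) (W_ni : no_isolated_point W)
  (Q : 'M[R]_n) (Q_diag : is_diag_mx Q) (Q_gt0 : forall i, 0 < Q i i)
  (u : nat -> 'cV[R]_n) (u_modes : fourier_modes (dvar W) Q u)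
  (k : nat) (k_bounds : (1 <= k <= n - 1)%N)
  (V : 'M[R]_(n, n - k)) (V_basis : orthonormal_basis V (orthoQ Q u k)) :
  finite_set [set x : 'cV[R]_(n - k) | enorm x = 1 /\ dvar W (V *m x) = 0] ->
  finite_set (critical_points
    (fun x : 'cV[R]_(n - k) => dvar W (V *m x))
    (fun x : 'cV[R]_(n - k) => enorm (diag_sqrt Q *m (V *m x)))).
Proof.
(* Here [L] is [diag_sqrt Q *m V], injective because [Q] has positive diagonal entries and [V] has
   orthonormal columns. *)
move=> finN; have L_inj (x : 'cV[R]_(n - k)) : diag_sqrt Q *m V *m x = 0 -> x = 0.
  rewrite -mulmxA => /(diag_sqrt_mul_eq0 Q_gt0).
  exact: orthonormal_basis_mul_eq0 V_basis.
have := finite_critical_points W_ge0 L_inj finN.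
by under [X in critical_points _ X]funext => x do rewrite -mulmxA.
Qed.
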